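(* Let $l,k,\rho,c,q_0,h_0,D_\infty>0$ and $0<\epsilon<1$ be given, and consider the coefficient $\gamma>0$ as an unknown of the free boundary problem (P) described in the context. Then the solution of (P), including the unknown coefficient $\gamma$, is given by, with $\alpha=\frac{k}{\rho c}$, $$T(x,t)=\frac{q_0\sqrt{\pi\alpha}}{k}\left[\operatorname{erf}\left(\frac{x}{2\sqrt{\alpha t}}\right)-\operatorname{erf}(\xi)\right]\quad (0<x<s(t),\ t>0),$$ $$s(t)=2\xi\sqrt{\alpha t},\qquad r(t)=2\left[\xi+\frac{\gamma k}{2q_0\sqrt{\alpha}}\exp(\xi^2)\right]\sqrt{\alpha t}\quad (t>0),$$ with $\gamma>0$ and $\xi>0$ given by $$\gamma=\frac{2q_0}{(1-\epsilon)\sqrt{k\rho c}}\left(\frac{q_0}{l}\sqrt{\frac{c}{\rho k}}-f_2(\xi)\right)\exp(-2\xi^2),\qquad \xi=\operatorname{erf}^{-1}\left(\frac{D_\infty}{q_0}\sqrt{\frac{k\rho c}{\pi}}\left(1-\frac{q_0}{h_0D_\infty}\right)\right),$$ if and only if the following three inequalities hold: $$1-\frac{q_0}{h_0D_\infty}>0,\qquad \frac{D_\infty}{q_0}\sqrt{\frac{k\rho c}{\pi}}\left(1-\frac{q_0}{h_0D_\infty}\right)<1,$$ $$f_2\left(\operatorname{erf}^{-1}\left(\frac{D_\infty}{q_0}\sqrt{\frac{k\rho c}{\pi}}\left(1-\frac{q_0}{h_0D_\infty}\right)\right)\right)<\frac{q_0}{l}\sqrt{\frac{c}{\rho k}},$$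 where $f_2(x)=x\exp(x^2)$ for $x>0$. (That is: there exist $\gamma>0$ and $\xi>0$ such that the triple $(T,s,r)$ with $T(x,t)=\frac{q_0\sqrt{\pi\alpha}}{k}\left[\operatorname{erf}\left(\frac{x}{2\sqrt{\alpha t}}\right)-\operatorname{erf}(\xi)\right]$, $s(t)=2\xi\sqrt{\alpha t}$ and $r(t)=2\left[\xi+\frac{\gamma k}{2q_0\sqrt{\alpha}}\exp(\xi^2)\right]\sqrt{\alpha t}$ solves (P) if and only if these inequalities hold, and in that case $\xi=\operatorname{erf}^{-1}\left(\frac{D_\infty}{q_0}\sqrt{\frac{k\rho c}{\pi}}\left(1-\frac{q_0}{h_0D_\infty}\right)\right)$ and $\gamma=\frac{2q_0}{(1-\epsilon)\sqrt{k\rho c}}\left(\frac{q_0}{l}\sqrt{\frac{c}{\rho k}}-f_2(\xi)\right)\exp(-2\xi^2)$.)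
   Context: Problem (P): find $T=T(x,t)$ and free boundaries $x=s(t)$, $x=r(t)$ such that $$\rho c\,T_t(x,t)-kT_{xx}(x,t)=0,\quad 0<x<s(t),\ t>0;$$ $$T(s(t),t)=0,\quad t>0;$$ $$kT_x(s(t),t)=\rho l\,[\epsilon\dot s(t)+(1-\epsilon)\dot r(t)],\quad t>0;$$ $$T_x(s(t),t)\,(r(t)-s(t))=\gamma,\quad t>0;$$ $$r(0)=s(0)=0;$$ $$kT_x(0,t)=\frac{q_0}{\sqrt t},\quad t>0;$$ $$kT_x(0,t)=\frac{h_0}{\sqrt t}\,(T(0,t)+D_\infty),\quad t>0.$$ All parameters $l,k,\rho,c,\gamma,q_0,h_0,D_\infty$ are positive real constants and $0<\epsilon<1$. Here $T$ and $T_x$ at $x=0$ and $x=s(t)$ are the boundary values from $0<x<s(t)$. The error function is $\operatorname{erf}(x)=\frac{2}{\sqrt\pi}\int_0^x e^{-u^2}\,du$, and $\operatorname{erf}^{-1}:(0,1)\to(0,\infty)$ is the inverse of its restriction to $(0,\infty)$. The third inequality is only considered when the first two hold, so that $\operatorname{erf}^{-1}$ is defined. *)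

(* Defs.v *)
From Stdlib Require Import Reals ClassicalEpsilon.
From Coquelicot Require Import Coquelicot.
Open Scope R_scope.

Definition erf (x : R) : R := 2 / sqrt PI * RInt (fun u => exp (- u ^ 2)) 0 x.

(* Meaningful for 0 < y < 1 only; outside (0,1) the value is arbitrary. *)
Definition erf_inv (y : R) : R :=
  epsilon (inhabits 0) (fun x => 0 < x /\ erf x = y).

Definition f2 (x : R) : R := x * exp (x ^ 2).

Definition dx (T : R -> R -> R) (x t : R) : R := Derive (fun y => T y t) x.
Definition dt (T : R -> R -> R) (x t : R) : R := Derive (fun u => T x u) t.

(* T is a total function, but only its values on 0 < x < s(t), t > 0 matter:
   the traces of T and T_x at x = 0 and x = s(t) are one-sided limits from
   inside this region. *)
Definition trace_right (f : R -> R) (a v : R) : Prop :=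
  filterlim f (at_right a) (locally v).
Definition trace_left (f : R -> R) (a v : R) : Prop :=
  filterlim f (at_left a) (locally v).

Record solves_P (l k rho c gamma q0 h0 Dinf eps : R)
    (T : R -> R -> R) (s r : R -> R) : Prop := {
  (* implicit in the problem: otherwise the traces have no meaning *)
  P_region : forall t, 0 < t -> 0 < s t;
  P_regular_T : forall x t, 0 < t -> 0 < x < s t ->
    ex_derive (fun u => T x u) t /\
    ex_derive (fun y => T y t) x /\
    ex_derive (fun y => dx T y t) x;
  P_regular_boundary : forall t, 0 < t -> ex_derive s t /\ ex_derive r t;
  P_heat : forall x t, 0 < t -> 0 < x < s t ->
    rho * c * dt T x t - k * dx (dx T) x t = 0;
  P_temperature_s : forall t, 0 < t -> trace_left (fun x => T x t) (s t) 0;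
  P_stefan : forall t, 0 < t -> exists Tx_s,
    trace_left (fun x => dx T x t) (s t) Tx_s /\
    k * Tx_s = rho * l * (eps * Derive s t + (1 - eps) * Derive r t);
  P_mushy : forall t, 0 < t -> exists Tx_s,
    trace_left (fun x => dx T x t) (s t) Tx_s /\
    Tx_s * (r t - s t) = gamma;
  P_initial : r 0 = 0 /\ s 0 = 0;
  P_flux : forall t, 0 < t -> exists Tx_0,
    trace_right (fun x => dx T x t) 0 Tx_0 /\
    k * Tx_0 = q0 / sqrt t;
  P_convective : forall t, 0 < t -> exists T_0 Tx_0,
    trace_right (fun x => T x t) 0 T_0 /\
    trace_right (fun x => dx T x t) 0 Tx_0 /\
    k * Tx_0 = h0 / sqrt t * (T_0 + Dinf)
}.

Definition T_sol (k alpha q0 xi : R) (x t : R) : R :=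
  q0 * sqrt (PI * alpha) / k * (erf (x / (2 * sqrt (alpha * t))) - erf xi).

Definition s_sol (alpha xi : R) (t : R) : R := 2 * xi * sqrt (alpha * t).

Definition r_sol (k alpha q0 gamma xi : R) (t : R) : R :=
  2 * (xi + gamma * k / (2 * q0 * sqrt alpha) * exp (xi ^ 2)) * sqrt (alpha * t).

(* Main.v *)
(** The similarity profile solves the heat equation and satisfies the conditions on
    [T (s t) t], on the mushy zone and on the flux whatever [gamma] and [xi] are. The
    convective condition then reads [erf xi = y] and the Stefan condition is affine in
    [gamma], with solution a positive multiple of [m - f2 xi]. Since [erf] is an
    increasing bijection from (0,oo) onto (0,1), [xi > 0] exists iff [0 < y < 1], and
    [gamma > 0] iff [f2 xi < m]. *)

Require Import Defs.
From Stdlib Require Import Reals Lra ClassicalEpsilon.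
From Coquelicot Require Import Coquelicot.
Open Scope R_scope.

(** * The Gaussian integral and a bound on its tail *)

Definition gauss (x : R) : R := RInt (fun u => exp (- u ^ 2)) 0 x.

Lemma is_derive_gauss (x : R) : is_derive gauss x (exp (- x ^ 2)).
Proof.
apply (is_derive_RInt (fun u => exp (- u ^ 2)) _ 0).
- apply filter_forall; intros y.
  apply (RInt_correct (V := R_CompleteNormedModule)).
  apply ex_RInt_continuous; intros z _.
  apply (ex_derive_continuous (V := R_NormedModule)); auto_derive; trivial.
- apply (ex_derive_continuous (V := R_NormedModule)); auto_derive; trivial.
Qed.

(* [gauss x ^ 2 + gauss_tail x] has zero derivative; this gives the Gaussian integral
   together with a bound on its tail. *)
Definition gauss_tail (x : R) : R :=
  RInt (fun u => exp (- (x ^ 2 * (1 + u ^ 2))) / (1 + u ^ 2)) 0 1.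

Lemma one_plus_sqr_pos (u : R) : 0 < 1 + u ^ 2.
Proof. nra. Qed.

Lemma ex_RInt_gauss_tail (x : R) :
  ex_RInt (fun u => exp (- (x ^ 2 * (1 + u ^ 2))) / (1 + u ^ 2)) 0 1.
Proof.
apply (ex_RInt_continuous (V := R_CompleteNormedModule)); intros z _.
apply (ex_derive_continuous (V := R_NormedModule)).
auto_derive; pose proof (one_plus_sqr_pos z); simpl in *; lra.
Qed.

(* The summand [+ 0] matches the affine substitution of [RInt_comp_lin]. *)
Lemma Derive_gauss_tail_integrand (x u : R) :
  Derive (fun z => exp (- (z ^ 2 * (1 + u ^ 2))) / (1 + u ^ 2)) x
  = - 2 * exp (- x ^ 2) * (x * exp (- (x * u + 0) ^ 2)).
Proof.
pose proof (one_plus_sqr_pos u).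
apply is_derive_unique; auto_derive; [trivial|].
replace (- (x * (x * 1) * (1 + u * (u * 1)))) with (- x ^ 2 + - (x * u + 0) ^ 2) by ring.
rewrite exp_plus; field; lra.
Qed.

(** The substitution [v = x * u], for [x] of any sign or zero. It recognises [gauss x] in the
    integral left after differentiating [gauss_tail]. *)
Lemma RInt_gauss_scale (x : R) :
  RInt (fun u => x * exp (- (x * u + 0) ^ 2)) 0 1 = gauss x.
Proof.
etransitivity;
  [apply (RInt_comp_lin (V := R_CompleteNormedModule) (fun u => exp (- u ^ 2)) x 0 0 1)|].
- apply (ex_RInt_continuous (V := R_CompleteNormedModule)); intros z _.
  apply (ex_derive_continuous (V := R_NormedModule)); auto_derive; trivial.
- unfold gauss; f_equal; ring.
Qed.

(** Differentiation under the integral sign cancels the denominator [1 + u ^ 2], and the exponential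
    splits into [exp (- x ^ 2)] and a rescaled Gaussian. The result is exactly the opposite of the
    derivative of [gauss x ^ 2]. *)
Lemma is_derive_gauss_tail (x : R) :
  is_derive gauss_tail x (- 2 * exp (- x ^ 2) * gauss x).
Proof.
replace (- 2 * exp (- x ^ 2) * gauss x) with
  (RInt (fun u => Derive (fun z => exp (- (z ^ 2 * (1 + u ^ 2))) / (1 + u ^ 2)) x) 0 1).
- apply is_derive_RInt_param.
  + apply filter_forall; intros y u _.
    auto_derive; trivial.
  (* Joint continuity of the partial derivative, proved on its factored form. *)
  + intros u _.
    apply continuity_2d_pt_ext with
      (f := fun x u => - 2 * exp (- x ^ 2) * (x * exp (- (x * u + 0) ^ 2))).
    { intros; symmetry; apply Derive_gauss_tail_integrand. }
    assert (He : forall z, continuity_pt (fun z => exp (- z ^ 2)) z).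
    { intros z; apply derivable_continuous_pt, ex_derive_Reals_0; auto_derive; trivial. }
    apply continuity_2d_pt_mult; [apply continuity_2d_pt_mult|apply continuity_2d_pt_mult].
    * apply continuity_2d_pt_const.
    * apply (continuity_1d_2d_pt_comp (fun z => exp (- z ^ 2))); [apply He|apply continuity_2d_pt_id1].
    * apply continuity_2d_pt_id1.
    * apply (continuity_1d_2d_pt_comp (fun z => exp (- z ^ 2))); [apply He|].
      apply continuity_2d_pt_plus; [apply continuity_2d_pt_mult|apply continuity_2d_pt_const].
      apply continuity_2d_pt_id1. apply continuity_2d_pt_id2.
  + apply filter_forall; intros y; apply ex_RInt_gauss_tail.
- rewrite (RInt_ext _ (fun u => scal (- 2 * exp (- x ^ 2)) (x * exp (- (x * u + 0) ^ 2)))).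
  + rewrite (RInt_scal (V := R_CompleteNormedModule)).
    * rewrite RInt_gauss_scale; reflexivity.
    * apply (ex_RInt_continuous (V := R_CompleteNormedModule)); intros z _.
      apply (ex_derive_continuous (V := R_NormedModule)); auto_derive; trivial.
  + intros; apply Derive_gauss_tail_integrand.
Qed.

(** At [x = 0] the integrand is [/ (1 + u ^ 2)], the derivative of [atan]. This is where [PI]
    enters. *)
Lemma gauss_tail_0 : gauss_tail 0 = PI / 4.
Proof.
unfold gauss_tail.
apply (is_RInt_unique (V := R_CompleteNormedModule)).
replace (PI / 4) with (minus (atan 1) (atan 0)) by
  (rewrite atan_1, atan_0; unfold minus, plus, opp; simpl; ring).
apply (is_RInt_derive (V := R_CompleteNormedModule)).
- intros x _. apply is_derive_Reals.
  replace (exp (- (0 ^ 2 * (1 + x ^ 2))) / (1 + x ^ 2)) with (/ (1 + x ^ 2)).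
  + apply derivable_pt_lim_atan.
  + replace (- (0 ^ 2 * (1 + x ^ 2))) with 0 by ring; rewrite exp_0; unfold Rdiv; ring.
- intros z _.
  apply (ex_derive_continuous (V := R_NormedModule)).
  auto_derive; pose proof (one_plus_sqr_pos z); simpl in *; lra.
Qed.

Lemma gauss_sqr (x : R) : gauss x ^ 2 = PI / 4 - gauss_tail x.
Proof.
assert (Hd : forall z, is_derive (fun z => gauss z ^ 2 + gauss_tail z) z 0).
{ intros z.
  pose proof (is_derive_gauss z) as H1; pose proof (is_derive_gauss_tail z) as H2.
  auto_derive.
  - split; [eexists; apply H1|split; [eexists; apply H2|trivial]].
  - apply is_derive_unique in H1, H2.
    change (fun x => gauss x) with gauss; change (fun x => gauss_tail x) with gauss_tail.
    rewrite H1, H2; ring. }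
assert (H0 : gauss 0 = 0) by apply (RInt_point (V := R_CompleteNormedModule)).
enough (gauss x ^ 2 + gauss_tail x = gauss 0 ^ 2 + gauss_tail 0) as E.
{ rewrite H0, gauss_tail_0 in E; simpl in E |- *; lra. }
destruct (MVT_gen (fun z => gauss z ^ 2 + gauss_tail z) 0 x (fun _ => 0)) as [z [_ E]].
- intros; apply Hd.
- intros z _; apply derivable_continuous_pt, ex_derive_Reals_0; eexists; apply Hd.
- simpl in E |- *; lra.
Qed.

(** The integrand is positive and, because [1 + u ^ 2 >= 1], at most [exp (- x ^ 2)]. Positivity
    keeps [erf] below 1; the upper bound makes [erf] approach 1. *)
Lemma gauss_tail_bounds (x : R) : 0 < gauss_tail x <= exp (- x ^ 2).
Proof.
split.
- apply RInt_gt_0; [lra| |].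
  + intros u _; apply Rdiv_lt_0_compat; [apply exp_pos|apply one_plus_sqr_pos].
  + intros z _. apply (ex_derive_continuous (V := R_NormedModule)).
    auto_derive; pose proof (one_plus_sqr_pos z); simpl in *; lra.
- replace (exp (- x ^ 2)) with (RInt (fun _ => exp (- x ^ 2)) 0 1)
    by (rewrite RInt_const; unfold scal; simpl; unfold mult; simpl; ring).
  apply RInt_le; [lra|apply ex_RInt_gauss_tail|apply ex_RInt_const|].
  intros u _. apply Rle_div_l; [apply one_plus_sqr_pos|].
  assert (exp (- (x ^ 2 * (1 + u ^ 2))) <= exp (- x ^ 2)).
  { assert (0 <= x ^ 2 * u ^ 2) by (apply Rmult_le_pos; apply pow2_ge_0).
    destruct (Rle_lt_or_eq_dec (- (x ^ 2 * (1 + u ^ 2))) (- x ^ 2)) as [L|L];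
      [lra|left; apply exp_increasing, L|rewrite L; lra]. }
  pose proof (exp_pos (- x ^ 2)); pose proof (pow2_ge_0 u); nra.
Qed.

(** * The error function as an increasing bijection from (0,oo) onto (0,1) *)

Lemma sqrt_PI_pos : 0 < sqrt PI.
Proof. apply sqrt_lt_R0, PI_RGT_0. Qed.

Lemma is_derive_erf (x : R) : is_derive erf x (2 / sqrt PI * exp (- x ^ 2)).
Proof. apply (is_derive_scal gauss), is_derive_gauss. Qed.

Lemma erf_0 : erf 0 = 0.
Proof. unfold erf; rewrite RInt_point; unfold zero; simpl; ring. Qed.

Lemma erf_increasing (x y : R) : x < y -> erf x < erf y.
Proof.
intros Hxy.
destruct (MVT_gen erf x y (fun z => 2 / sqrt PI * exp (- z ^ 2))) as [z [_ E]].
- intros; apply is_derive_erf.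
- intros z _; apply derivable_continuous_pt, ex_derive_Reals_0; eexists; apply is_derive_erf.
- assert (0 < 2 / sqrt PI * exp (- z ^ 2) * (y - x)); [|lra].
  apply Rmult_lt_0_compat; [|lra].
  apply Rmult_lt_0_compat; [|apply exp_pos].
  apply Rdiv_lt_0_compat; [lra|apply sqrt_PI_pos].
Qed.

Lemma erf_inj (x y : R) : erf x = erf y -> x = y.
Proof.
intros E; destruct (Rtotal_order x y) as [L|[L|L]]; trivial;
  apply erf_increasing in L; lra.
Qed.

Lemma erf_sqr (x : R) : erf x ^ 2 = 1 - 4 / PI * gauss_tail x.
Proof.
change (erf x) with (2 / sqrt PI * gauss x).
pose proof PI_RGT_0; pose proof sqrt_PI_pos.
replace ((2 / sqrt PI * gauss x) ^ 2) with (4 / (sqrt PI * sqrt PI) * gauss x ^ 2) by (field; lra).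
rewrite sqrt_sqrt, gauss_sqr by lra; field; lra.
Qed.

Lemma erf_lt_1 (x : R) : erf x < 1.
Proof.
pose proof (erf_sqr x) as E; destruct (gauss_tail_bounds x) as [L _].
assert (0 < 4 / PI * gauss_tail x).
{ apply Rmult_lt_0_compat; trivial; apply Rdiv_lt_0_compat; [lra|apply PI_RGT_0]. }
nra.
Qed.

Lemma erf_pos (x : R) : 0 < x -> 0 < erf x.
Proof. intros H; apply erf_increasing in H; rewrite erf_0 in H; trivial. Qed.

Lemma erf_surj (y : R) : 0 < y < 1 -> exists x, 0 < x /\ erf x = y.
Proof.
intros Hy.
pose proof PI2_1 as HP.
(* With this [X], [exp (- X ^ 2) < / X = (1 - y) / 2], because [exp (X ^ 2) > 1 + X ^ 2 > X]. Since
   [4 / PI <= 2], this gives [erf X ^ 2 > 1 - (1 - y) = y], hence [erf X > y]. *)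
assert (HX : 0 < 2 / (1 - y)) by (apply Rdiv_lt_0_compat; lra).
set (X := 2 / (1 - y)) in *.
assert (Hlarge : y < erf X).
{ pose proof (erf_pos X HX); pose proof (erf_sqr X) as E.
  destruct (gauss_tail_bounds X) as [L0 L].
  assert (exp (- X ^ 2) < (1 - y) / 2).
  { rewrite exp_Ropp. replace ((1 - y) / 2) with (/ X) by (unfold X; field; lra).
    apply Rinv_lt_contravar; [apply Rmult_lt_0_compat; [lra|apply exp_pos]|].
    assert (X ^ 2 <> 0) by (apply pow_nonzero; lra).
    pose proof (exp_ineq1 (X ^ 2) ltac:(trivial)).
    nra. }
  assert (4 / PI <= 2) by (apply Rle_div_l; lra).
  nra. }
destruct (IVT_gen erf 0 X y) as [x [Hx E]].
- intros z; apply derivable_continuous_pt, ex_derive_Reals_0; eexists; apply is_derive_erf.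
- rewrite erf_0, Rmin_left, Rmax_right; lra.
- exists x; split; trivial.
  rewrite Rmin_left in Hx by lra.
  (* The intermediate value theorem only gives [0 <= x]; the endpoint is excluded by
     [erf 0 = 0 < y]. *)
  destruct (Req_dec x 0) as [->|]; [rewrite erf_0 in E|]; lra.
Qed.

(** The chosen preimage has the same image as [x], so injectivity of [erf] makes the choice
    irrelevant. *)
Lemma erf_inv_erf (x : R) : 0 < x -> erf_inv (erf x) = x.
Proof.
intros Hx; apply erf_inj; unfold erf_inv.
apply (epsilon_spec (inhabits 0) (fun z => 0 < z /\ erf z = erf x)); eauto.
Qed.

(** * One-sided traces and the speed of the free boundaries *)

Lemma trace_right_iff (f : R -> R) (a v : R) :
  ex_derive f a -> trace_right f a v <-> v = f a.
Proof.
intros Hf.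
assert (Hc : filterlim f (at_right a) (locally (f a))).
{ eapply filterlim_filter_le_1; [apply filter_le_within|].
  apply (ex_derive_continuous (V := R_NormedModule)), Hf. }
split; [intros Hv|intros ->; exact Hc].
exact (filterlim_locally_unique (V := R_NormedModule) f _ _ Hv Hc).
Qed.

Lemma trace_left_iff (f : R -> R) (a v : R) :
  ex_derive f a -> trace_left f a v <-> v = f a.
Proof.
intros Hf.
assert (Hc : filterlim f (at_left a) (locally (f a))).
{ eapply filterlim_filter_le_1; [apply filter_le_within|].
  apply (ex_derive_continuous (V := R_NormedModule)), Hf. }
split; [intros Hv|intros ->; exact Hc].
exact (filterlim_locally_unique (V := R_NormedModule) f _ _ Hv Hc).
Qed.

(** Both [s_sol] and [r_sol] are of this form, with different constants [C]. *)
Lemma is_derive_sqrt_scaled (C alpha t : R) : 0 < alpha -> 0 < t ->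
  is_derive (fun u => C * sqrt (alpha * u)) t (C * sqrt alpha / (2 * sqrt t)).
Proof.
intros Ha Ht.
pose proof (sqrt_lt_R0 _ Ha); pose proof (sqrt_lt_R0 _ Ht).
auto_derive; [apply Rmult_lt_0_compat; trivial|].
rewrite sqrt_mult_alt by lra.
replace alpha with (sqrt alpha * sqrt alpha) at 1 by (apply sqrt_sqrt; lra).
field; lra.
Qed.

(** * Derivatives and boundary values of the similarity profile *)

Section SimilaritySolution.

Variables k alpha q0 xi : R.
Hypotheses (hk : 0 < k) (halpha : 0 < alpha).

Let T := T_sol k alpha q0 xi.
(** The similarity variable, which is constantly [xi] along the free boundary [s_sol]. *)
Let eta (x t : R) := x / (2 * sqrt (alpha * t)).

Lemma is_derive_T_sol_x (x t : R) : 0 < t ->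
  is_derive (fun y => T y t) x (q0 / (k * sqrt t) * exp (- eta x t ^ 2)).
Proof.
intros Ht.
pose proof (sqrt_lt_R0 _ halpha); pose proof (sqrt_lt_R0 _ Ht); pose proof sqrt_PI_pos.
pose proof PI_RGT_0.
pose proof (is_derive_erf (eta x t)) as H3.
unfold T, T_sol; auto_derive; [eexists; exact H3|].
apply is_derive_unique in H3; change (fun x => erf x) with erf.
change (x * / (2 * sqrt (alpha * t))) with (eta x t); rewrite H3.
rewrite !sqrt_mult_alt by lra.
field; lra.
Qed.

Lemma dx_T_sol (x t : R) : 0 < t ->
  dx T x t = q0 / (k * sqrt t) * exp (- eta x t ^ 2).
Proof. intros Ht; apply is_derive_unique, is_derive_T_sol_x, Ht. Qed.

Lemma is_derive_T_sol_t (x t : R) : 0 < t ->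
  is_derive (fun u => T x u) t
    (- (q0 * sqrt alpha / (k * t)) * eta x t * exp (- eta x t ^ 2)).
Proof.
intros Ht.
pose proof (sqrt_lt_R0 _ halpha); pose proof (sqrt_lt_R0 _ Ht); pose proof sqrt_PI_pos.
pose proof PI_RGT_0.
pose proof (is_derive_erf (eta x t)) as H3.
(* [eta] is homogeneous of degree -1/2 in time. *)
assert (Heta : is_derive (fun u => eta x u) t (- eta x t / (2 * t))).
{ unfold eta; auto_derive.
  - repeat split; [apply Rmult_lt_0_compat; trivial|].
    rewrite sqrt_mult_alt by lra; nra.
  - rewrite !sqrt_mult_alt by lra.
    rewrite <- (sqrt_sqrt alpha) at 1 by lra.
    rewrite <- (sqrt_sqrt t) at 5 by lra.
    field; lra. }
pose proof (is_derive_scal _ _ (q0 * sqrt (PI * alpha) / k)  _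
  (is_derive_minus _ _ _ _ _ (is_derive_comp _ _ _ _ _ H3 Heta) (is_derive_const (erf xi) t)))
  as HT.
(* The chain rule gives the derivative in raw form; [eq_ind] reduces the goal to its equality with
   the stated value. *)
eapply is_derive_ext in HT; [eapply eq_ind; [exact HT|]|reflexivity].
unfold minus, plus, opp, scal, zero; simpl; unfold mult; simpl.
rewrite sqrt_mult_alt by lra.
field; lra.
Qed.

Lemma is_derive_dx_T_sol (x t : R) : 0 < t ->
  is_derive (fun y => dx T y t) x
    (- (q0 / (k * t * sqrt alpha)) * eta x t * exp (- eta x t ^ 2)).
Proof.
intros Ht.
pose proof (sqrt_lt_R0 _ halpha); pose proof (sqrt_lt_R0 _ Ht).
apply (is_derive_ext (fun y => q0 / (k * sqrt t) * exp (- eta y t ^ 2))).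
{ intros y; symmetry; apply dx_T_sol, Ht. }
unfold eta; auto_derive; trivial.
replace (- (x * / (2 * sqrt (alpha * t)) * (x * / (2 * sqrt (alpha * t)) * 1)))
  with (- (x / (2 * sqrt (alpha * t))) ^ 2) by (unfold Rdiv; ring).
rewrite sqrt_mult_alt by lra.
rewrite <- (sqrt_sqrt t) at 5 by lra.
field; lra.
Qed.

(** Both sides are multiples of [eta x t * exp (- eta x t ^ 2)], with prefactors that differ by
    [alpha]. *)
Lemma T_sol_heat (x t : R) : 0 < t -> dt T x t = alpha * dx (dx T) x t.
Proof.
intros Ht.
pose proof (sqrt_lt_R0 _ halpha).
pose proof (is_derive_unique _ _ _ (is_derive_T_sol_t x t Ht)) as H1.
pose proof (is_derive_unique _ _ _ (is_derive_dx_T_sol x t Ht)) as H2.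
unfold dt; unfold dx at 1; etransitivity; [exact H1|].
etransitivity; [|symmetry; apply f_equal, H2].
rewrite <- (sqrt_sqrt alpha) at 2 by lra; field; lra.
Qed.

Lemma eta_s_sol (t : R) : 0 < t -> eta (s_sol alpha xi t) t = xi.
Proof.
intros Ht; unfold eta, s_sol.
pose proof (sqrt_lt_R0 _ (Rmult_lt_0_compat _ _ halpha Ht)); field; lra.
Qed.

Lemma T_sol_at_0 (t : R) : T 0 t = - (q0 * sqrt (PI * alpha) / k * erf xi).
Proof. unfold T, T_sol, Rdiv at 2; rewrite Rmult_0_l, erf_0; ring. Qed.

Lemma dx_T_sol_at_0 (t : R) : 0 < t -> dx T 0 t = q0 / (k * sqrt t).
Proof.
intros Ht; rewrite dx_T_sol by trivial.
unfold eta, Rdiv at 2; replace (- (0 * / (2 * sqrt (alpha * t))) ^ 2) with 0 by ring.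
rewrite exp_0; ring.
Qed.

Lemma dx_T_sol_at_s (t : R) : 0 < t ->
  dx T (s_sol alpha xi t) t = q0 / (k * sqrt t) * exp (- xi ^ 2).
Proof. intros Ht; rewrite dx_T_sol, eta_s_sol; trivial. Qed.

End SimilaritySolution.

(** * Reduction of (P) to two scalar equations *)

Lemma solves_P_iff (l k rho c gamma q0 h0 Dinf eps alpha xi : R) :
  0 < l -> 0 < k -> 0 < rho -> 0 < c -> 0 < q0 -> 0 < h0 -> 0 < alpha -> 0 < xi ->
  rho * c * alpha = k ->
  solves_P l k rho c gamma q0 h0 Dinf eps
    (T_sol k alpha q0 xi) (s_sol alpha xi) (r_sol k alpha q0 gamma xi) <->
  q0 = h0 * (Dinf - q0 * sqrt (PI * alpha) / k * erf xi) /\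
  q0 * exp (- xi ^ 2) =
    rho * l * (xi * sqrt alpha + (1 - eps) * (gamma * k / (2 * q0) * exp (xi ^ 2))).
Proof.
intros hl hk hrho hc hq0 hh0 halpha hxi Hk.
pose proof (sqrt_lt_R0 _ halpha) as Hsa.
assert (HT : forall x t, 0 < t -> ex_derive (fun y => T_sol k alpha q0 xi y t) x)
  by (intros; eexists; apply is_derive_T_sol_x; trivial).
assert (HTx : forall x t, 0 < t -> ex_derive (fun y => dx (T_sol k alpha q0 xi) y t) x)
  by (intros; eexists; apply is_derive_dx_T_sol; trivial).
(* The profile is differentiable across [x = 0] and [x = s t], so every trace quantified
   existentially in [solves_P] is unique and explicit. *)
assert (Ht0 : forall t v, 0 < t -> trace_right (fun x => T_sol k alpha q0 xi x t) 0 v <->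
  v = - (q0 * sqrt (PI * alpha) / k * erf xi))
  by (intros; rewrite trace_right_iff, T_sol_at_0; [reflexivity|auto]).
assert (Htx0 : forall t v, 0 < t -> trace_right (fun x => dx (T_sol k alpha q0 xi) x t) 0 v <->
  v = q0 / (k * sqrt t))
  by (intros; rewrite trace_right_iff, dx_T_sol_at_0; [reflexivity|auto..]).
assert (Htxs : forall t v, 0 < t ->
  trace_left (fun x => dx (T_sol k alpha q0 xi) x t) (s_sol alpha xi t) v <->
  v = q0 / (k * sqrt t) * exp (- xi ^ 2))
  by (intros; rewrite trace_left_iff, dx_T_sol_at_s; [reflexivity|auto..]).
assert (Hds : forall t, 0 < t -> is_derive (s_sol alpha xi) t (xi * sqrt alpha / sqrt t)).
{ intros t Ht; pose proof (sqrt_lt_R0 _ Ht).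
  replace (xi * sqrt alpha / sqrt t) with (2 * xi * sqrt alpha / (2 * sqrt t)) by (field; lra).
  apply is_derive_sqrt_scaled; trivial. }
assert (Hdr : forall t, 0 < t -> is_derive (r_sol k alpha q0 gamma xi) t
  ((xi * sqrt alpha + gamma * k / (2 * q0) * exp (xi ^ 2)) / sqrt t)).
{ intros t Ht; pose proof (sqrt_lt_R0 _ Ht).
  replace ((xi * sqrt alpha + gamma * k / (2 * q0) * exp (xi ^ 2)) / sqrt t) with
    (2 * (xi + gamma * k / (2 * q0 * sqrt alpha) * exp (xi ^ 2)) * sqrt alpha / (2 * sqrt t))
    by (field; lra).
  apply is_derive_sqrt_scaled; trivial. }
split.
(* In the convective and Stefan conditions both sides scale as [/ sqrt t], so the instance [t = 1]
   already contains all the information. *)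
- intros H; split.
  + destruct (P_convective _ _ _ _ _ _ _ _ _ _ _ _ H 1 Rlt_0_1) as (T0 & T1 & H0 & H1 & E).
    apply Ht0 in H0; [|lra]; apply Htx0 in H1; [|lra]; subst T0 T1.
    rewrite sqrt_1 in E.
    replace (k * (q0 / (k * 1))) with q0 in E by (field; lra).
    rewrite E at 1; field; lra.
  + destruct (P_stefan _ _ _ _ _ _ _ _ _ _ _ _ H 1 Rlt_0_1) as (T1 & H1 & E).
    apply Htxs in H1; [|lra]; subst T1.
    rewrite (is_derive_unique _ _ _ (Hds 1 Rlt_0_1)),
      (is_derive_unique _ _ _ (Hdr 1 Rlt_0_1)), sqrt_1 in E.
    replace (k * (q0 / (k * 1) * exp (- xi ^ 2))) with (q0 * exp (- xi ^ 2)) in E by (field; lra).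
    rewrite E; field; lra.
- intros [E1 E2]; split.
  + intros t Ht; unfold s_sol.
    pose proof (sqrt_lt_R0 _ (Rmult_lt_0_compat _ _ halpha Ht)); nra.
  + intros x t Ht _; split; [|split]; auto.
    eexists; apply is_derive_T_sol_t; trivial.
  + intros t Ht; split; eexists; eauto.
  + intros x t Ht _; rewrite T_sol_heat by trivial.
    rewrite <- Hk; ring.
  + intros t Ht; apply trace_left_iff; auto.
    unfold T_sol; fold (s_sol alpha xi t).
    rewrite eta_s_sol by trivial; ring.
  + intros t Ht; pose proof (sqrt_lt_R0 _ Ht).
    eexists; split; [apply Htxs; trivial|].
    rewrite (is_derive_unique _ _ _ (Hds t Ht)), (is_derive_unique _ _ _ (Hdr t Ht)).
    replace (k * (q0 / (k * sqrt t) * exp (- xi ^ 2)))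
      with (q0 * exp (- xi ^ 2) / sqrt t) by (field; lra).
    rewrite E2; field; lra.
  (* In the mushy condition the width [r t - s t] carries [exp (xi ^ 2)] and the gradient its
     inverse; the powers of [t] cancel as well, leaving [gamma]. *)
  + intros t Ht; pose proof (sqrt_lt_R0 _ Ht); pose proof (exp_pos (xi ^ 2)).
    eexists; split; [apply Htxs; trivial|].
    unfold r_sol, s_sol; rewrite sqrt_mult_alt, exp_Ropp by lra; field; lra.
  + unfold r_sol, s_sol; rewrite Rmult_0_r, sqrt_0; split; ring.
  + intros t Ht; pose proof (sqrt_lt_R0 _ Ht).
    eexists; split; [apply Htx0; trivial|]; field; lra.
  + intros t Ht; pose proof (sqrt_lt_R0 _ Ht).
    do 2 eexists; split; [apply Ht0; trivial|split; [apply Htx0; trivial|]].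
    replace (k * (q0 / (k * sqrt t))) with (q0 / sqrt t) by (field; lra).
    rewrite E1 at 1; field; lra.
Qed.

(** * Solving the two scalar equations for [xi] and [gamma] *)

Theorem theorem3p2 (l k rho c q0 h0 Dinf eps : R)
  (hl : 0 < l) (hk : 0 < k) (hrho : 0 < rho) (hc : 0 < c)
  (hq0 : 0 < q0) (hh0 : 0 < h0) (hDinf : 0 < Dinf) (heps : 0 < eps < 1) :
  let alpha := k / (rho * c) in
  let y := Dinf / q0 * sqrt (k * rho * c / PI) * (1 - q0 / (h0 * Dinf)) in
  let m := q0 / l * sqrt (c / (rho * k)) in
  let is_solution gamma xi :=
    0 < gamma /\ 0 < xi /\
    solves_P l k rho c gamma q0 h0 Dinf eps
      (T_sol k alpha q0 xi) (s_sol alpha xi) (r_sol k alpha q0 gamma xi) in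
  ((exists gamma xi, is_solution gamma xi) <->
     (1 - q0 / (h0 * Dinf) > 0 /\ y < 1 /\ f2 (erf_inv y) < m)) /\
  (forall gamma xi, is_solution gamma xi ->
     xi = erf_inv y /\
     gamma = 2 * q0 / ((1 - eps) * sqrt (k * rho * c)) * (m - f2 xi)
             * exp (-2 * xi ^ 2)).
Proof.
intros alpha y m is_solution.
pose proof PI_RGT_0 as HPI; pose proof sqrt_PI_pos as HsPI.
assert (Hrc : 0 < rho * c) by (apply Rmult_lt_0_compat; trivial).
assert (halpha : 0 < alpha) by (apply Rdiv_lt_0_compat; trivial).
assert (Hk : rho * c * alpha = k) by (unfold alpha; field; lra).
(* Writing [k] as [rho * c * (a * a)] makes every square root of the parameters rational in [rho],
   [c], [a] and [sqrt PI], within reach of [field]. *)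
set (a := sqrt alpha).
assert (Ha : 0 < a) by (apply sqrt_lt_R0; trivial).
assert (Haa : rho * c * (a * a) = k) by (unfold a; rewrite sqrt_sqrt by lra; exact Hk).
assert (E1 : sqrt (k * rho * c) = rho * c * a).
{ apply sqrt_lem_1; [nra|nra|rewrite <- Haa; ring]. }
assert (E2 : sqrt (k * rho * c / PI) = rho * c * a / sqrt PI).
{ rewrite sqrt_div_alt by lra; rewrite E1; reflexivity. }
assert (E3 : sqrt (c / (rho * k)) = / (rho * a)).
{ assert (0 < rho * a) by nra.
  apply sqrt_lem_1.
  - apply Rlt_le, Rdiv_lt_0_compat; nra.
  - apply Rlt_le, Rinv_0_lt_compat; trivial.
  - rewrite <- Haa; field; lra. }
set (g := fun xi => 2 * q0 / ((1 - eps) * sqrt (k * rho * c)) * (m - f2 xi)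
             * exp (-2 * xi ^ 2)).
assert (Hcoef : 0 < 2 * q0 / ((1 - eps) * sqrt (k * rho * c))).
{ rewrite E1; apply Rdiv_lt_0_compat; [lra|].
  apply Rmult_lt_0_compat; [lra|apply Rmult_lt_0_compat; lra]. }
assert (Hg : forall xi, 0 < g xi <-> f2 xi < m).
{ intros xi; unfold g; pose proof (exp_pos (-2 * xi ^ 2)); split; intros H1.
  - apply Rnot_le_lt; intros H2.
    assert (0 <= 2 * q0 / ((1 - eps) * sqrt (k * rho * c)) * (f2 xi - m) * exp (-2 * xi ^ 2))
      by (apply Rmult_le_pos; [apply Rmult_le_pos|]; lra).
    lra.
  - apply Rmult_lt_0_compat; [apply Rmult_lt_0_compat|]; lra. }
assert (Hy : 0 < Dinf / q0 * sqrt (k * rho * c / PI)).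
{ rewrite E2; apply Rmult_lt_0_compat; apply Rdiv_lt_0_compat; trivial.
  apply Rmult_lt_0_compat; trivial. }
assert (Hconv : forall xi,
  q0 = h0 * (Dinf - q0 * sqrt (PI * alpha) / k * erf xi) <-> erf xi = y).
{ intros xi; unfold y; rewrite E2, sqrt_mult_alt by lra; fold a; rewrite <- Haa.
  split; intros H1; apply Rminus_diag_uniq.
  - apply Rminus_diag_eq in H1.
    (* The multiplier is the coefficient of [erf xi] in the difference of the two sides of the
       convective equation, so the product is that difference. *)
    apply Rmult_eq_reg_l with (h0 * q0 * sqrt PI / (rho * c * a)); [|apply Rgt_not_eq].
    + rewrite Rmult_0_r; rewrite <- H1; field; lra.
    + repeat (apply Rdiv_lt_0_compat || apply Rmult_lt_0_compat); trivial.
  - rewrite H1; field; lra. }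
assert (Hstefan : forall gamma xi,
  q0 * exp (- xi ^ 2) =
    rho * l * (xi * sqrt alpha + (1 - eps) * (gamma * k / (2 * q0) * exp (xi ^ 2))) <->
  gamma = g xi).
{ intros gamma xi; unfold g, m, f2; rewrite E1, E3; fold a; rewrite <- Haa.
  (* After this splitting all exponentials are powers of [e := exp (xi ^ 2)]. *)
  replace (-2 * xi ^ 2) with (- xi ^ 2 + - xi ^ 2) by ring.
  rewrite exp_plus, exp_Ropp.
  pose proof (exp_pos (xi ^ 2)) as He; set (e := exp (xi ^ 2)) in *.
  split; intros H1.
  - apply Rminus_diag_eq in H1; apply Rminus_diag_uniq.
    (* Likewise the coefficient of [gamma] in the Stefan equation, negative because [eps < 1]. *)
    apply Rmult_eq_reg_l with (- (rho * l * (1 - eps) * (rho * c * (a * a)) * e / (2 * q0)));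
      [|apply Ropp_neq_0_compat, Rgt_not_eq].
    + rewrite Rmult_0_r; rewrite <- H1; field; lra.
    + repeat (apply Rdiv_lt_0_compat || apply Rmult_lt_0_compat); lra.
  - rewrite H1; field; lra. }
assert (Hmain : forall gamma xi,
  is_solution gamma xi <-> 0 < gamma /\ 0 < xi /\ erf xi = y /\ gamma = g xi).
{ intros gamma xi; rewrite <- Hconv, <- Hstefan; unfold is_solution.
  split; intros (Hgam & Hxi & H); (split; [trivial|split; [trivial|]]);
    [apply solves_P_iff in H|apply solves_P_iff]; trivial. }
split; [split|].
- intros (gamma & xi & H); apply Hmain in H; destruct H as (Hgam & Hxi & H1 & ->).
  rewrite <- H1, erf_inv_erf by trivial.
  split; [|split; [apply erf_lt_1|apply Hg; trivial]].
  (* [y] is positive as a value of [erf] at [xi > 0], and its first factor is positive by [Hy], so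
     [1 - q0 / (h0 * Dinf)] must be positive too. *)
  pose proof (erf_pos xi Hxi) as H2; rewrite H1 in H2; unfold y in H2.
  apply Rnot_le_gt; intros H3; nra.
- intros (H1 & H2 & H3).
  destruct (erf_surj y) as (xi & Hxi & <-).
  { split; trivial; apply Rmult_lt_0_compat; trivial. }
  rewrite erf_inv_erf in H3 by trivial.
  exists (g xi), xi; apply Hmain.
  repeat split; trivial; apply Hg; trivial.
- intros gamma xi H; apply Hmain in H; destruct H as (_ & Hxi & <- & ->).
  rewrite erf_inv_erf by trivial; split; reflexivity.
Qed.
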